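(* Let $(A,+,\times,0_A,1_A)$ be a semiring, $B$ a set, $\Omega$ an $A$-pre-morphism with weights in $B$, and $W\in B^{V_G\times V_H}$, where $G,H$ are $\mathbf{e}$-free edge-labelled graphs and $\mathcal{R}\subseteq X_G\times X_H$. Let $(H_m,\dots,H_1)$ be a contraction sequence of $H$ ($m=|V_H|$), $k\in[m-1]$, and suppose $H_k$ is obtained from $H_{k+1}$ by merging two distinct vertices $T_p,T_{p+1}$ of $H_{k+1}$ into the vertex $T_0=T_p\uplus T_{p+1}$. Let $C_1,\dots,C_q$ ($q\ge1$) be distinct $\mathbf{e}$-connected components of $H_{k+1}$ with $\{T_1,\dots,T_{p-1},T_p,T_{p+1}\}=C_1\uplus\dots\uplus C_q$, and let $I_j\subseteq[p+1]$ be such that $C_j=\{T_i:i\in I_j\}$. Let $S_0,S_1,\dots,S_{p-1}$ be pairwise disjoint subsets of $V_G$, $\mathbb{S}=(S_1,\dots,S_{p-1})$, $\mathbb{T}=(T_1,\dots,T_{p-1})$. Then $$\Omega_W\big(\mathcal{R}^{\mathbb{S},S_0}_{\mathbb{T},T_0}\big)=\sum_{\substack{S_p\uplus S_{p+1}=S_0\\ (\mathbb{S},S_p,S_{p+1})\preceq_{\mathcal{R}}(\mathbb{T},T_p,T_{p+1})}}\ \prod_{j=1}^q\Omega_W\Big(\mathcal{R}^{(\mathbb{S},S_p,S_{p+1})_{I_j}}_{(\mathbb{T},T_p,T_{p+1})_{I_j}}\Big),$$ where the sum ranges over pairs $(S_p,S_{p+1})$ of disjoint subsets with union $S_0$, and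 $\sum,\prod$ are the semiring operations.
   Context: Edge-labelled graph: $G=(V_G,l_G,X_G)$, finite $V_G,X_G$, $l_G:V_G^2\to X_G$; $\mathbf{e}$-free if the special symbol $\mathbf{e}\notin X_G$; $G[S]=(S,l_G|_{S^2},X_G)$. $\mathcal{R}$-morphism $f:V_G\to V_H$: $(l_G(u,v),l_H(f(u),f(v)))\in\mathcal{R}$ for all $u,v$. Contraction relative to a partition $\mathcal{S}$ of $V_H$ into nonempty parts: vertex set $\mathcal{S}$, label $x$ on $(S_1,S_2)$ if $l_H$ is constantly $x$ on $S_1\times S_2$, else $\mathbf{e}$. Contraction sequence $(H_m,\dots,H_1)$: $H_m=H$, $H_k$ is the contraction relative to a partition with $k$ parts, successive partitions obtained by merging two parts, starting from singletons. $\mathbf{e}$-connected components: components of the undirected graph with edge $\{u,v\}$ iff $\mathbf{e}\in\{l(u,v),l(v,u)\}$. For tuples $\mathbb{S}=(S_1,\dots,S_r)$ of pairwise disjoint subsets of $V_G$ and $\mathbb{T}=(T_1,\dots,T_r)$ of pairwise disjoint subsets of $V_H$, $\mathcal{R}^{\mathbb{S}}_{\mathbb{T}}$ is the set of $\mathcal{R}$-morphisms $f$ from $G[S_1\uplus\dots\uplus S_r]$ to $H[T_1\uplus\dots\uplus T_r]$ with $f(S_i)\subseteq T_i$ for all $i$; commas denote concatenation of tuples and $(a)_I$ is the subtuple indexed by $I$ in increasing order. Feasibility: if $T_1,\dots,T_r$ are distinct vertices of a contraction $H'$ of $H$ and $S_i$ pairwise disjoint subsets of $V_G$, then $\mathbb{S}\preceq_{\mathcal{R}}\mathbb{T}$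 means: for all $i,i'$, if $l_{H'}(T_i,T_{i'})\neq\mathbf{e}$ then $(l_G(u,v),l_{H'}(T_i,T_{i'}))\in\mathcal{R}$ for all $(u,v)\in S_i\times S_{i'}$. Semiring and pre-morphism: $(A,+,0_A)$ commutative monoid, $(A,\times,1_A)$ monoid, distributivity, $0_A$ absorbing. Join of $f_i:S_i\to T_i$ with $S_1\cap S_2=\emptyset$: $f_1\bowtie f_2:S_1\uplus S_2\to T_1\cup T_2$ restricting to $f_i$; $\mathcal{F}_1\bowtie\mathcal{F}_2=\{f_1\bowtie f_2\}$. An $A$-pre-morphism with weights in $B$ assigns to edge-labelled graphs $G,H$, $S\subseteq V_G$, $T\subseteq V_H$, sets $\mathcal{F}$ of maps $S\to T$ and $W\in B^{V_G\times V_H}$ a value $\Omega_W(\mathcal{F})\in A$ with (i) additivity over disjoint unions of sets of maps $S\to T$; (ii) $\Omega_W(\mathcal{F}_1\bowtie\mathcal{F}_2)=\Omega_W(\mathcal{F}_1)\times\Omega_W(\mathcal{F}_2)$ for $\mathcal{F}_i$ sets of maps $S_i\to T_i$, $S_1\cap S_2=\emptyset$, $T_1\cap T_2=\emptyset$; (iii) $\Omega_W(\emptyset)=0_A$. *)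

(* Defs.v *)
From HB Require Import structures.
From mathcomp Require Import all_boot all_order all_algebra finmap.

Set Implicit Arguments.
Unset Strict Implicit.
Unset Printing Implicit Defensive.

Import GRing.Theory.
Local Open Scope ring_scope.

(* All labels, including the special symbol e, live in one type L, so that
   "e belongs to X_G" is meaningful and e-freeness is a genuine hypothesis. *)
Record elgraph (L : choiceType) := ELGraph {
  vert :> finType;
  labels : {fset L};
  lab : vert -> vert -> L;
  labP : forall u v, lab u v \in labels }.

Definition efree (L : choiceType) (e : L) (G : elgraph L) : bool :=
  e \notin labels G.

Definition induced (L : choiceType) (G : elgraph L) (S : {set G}) : elgraph L :=
  @ELGraph L {x : G | x \in S} (labels G) (fun u v => lab (val u) (val v))
    (fun u v => labP (val u) (val v)).

Definition is_morphism (L : choiceType) (R : {fset L * L}) (G H : elgraph L)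
    (f : G -> H) : bool :=
  [forall u : G, forall v : G, (lab u v, lab (f u) (f v)) \in R].

(* For S1 and S2 nonempty there is at most one x as in the pick. *)
Definition contraction_lab (L : choiceType) (e : L) (H : elgraph L)
    (S1 S2 : {set H}) : L :=
  if [pick x : labels H | [forall u in S1, forall v in S2, lab u v == val x]]
    is Some x then val x else e.

Lemma contraction_labP (L : choiceType) (e : L) (H : elgraph L)
    (S1 S2 : {set H}) :
  contraction_lab e S1 S2 \in (e |` labels H)%fset.
Proof.
rewrite /contraction_lab; case: pickP => [x _|_]; last exact: fset1U1.
by apply/fset1UP; right; exact: valP.
Qed.

(* Meant for P a partition of the vertices of H. *)
Definition contraction (L : choiceType) (e : L) (H : elgraph L)
    (P : {set {set H}}) : elgraph L :=
  @ELGraph L {S : {set H} | S \in P} (e |` labels H)%fset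
    (fun S1 S2 => contraction_lab e (val S1) (val S2))
    (fun S1 S2 => contraction_labP e (val S1) (val S2)).

Definition part (L : choiceType) (e : L) (H : elgraph L) (P : {set {set H}})
    (x : contraction e P) : {set H} := sval x.

Definition merge_parts (V : finType) (P : {set {set V}}) (S1 S2 : {set V}) :
    {set {set V}} :=
  (S1 :|: S2) |: (P :\: [set S1; S2]).

(* A contraction sequence (H_m, ..., H_1) is given by the underlying partitions:
   H_k is contraction e (P k), and only the values P k with 1 <= k <= m matter.
   H_m, relative to the partition into singletons, is H with u renamed {u}. *)
Definition contraction_seq (L : choiceType) (H : elgraph L)
    (P : nat -> {set {set H}}) : Prop :=
  [/\ P #|H| = [set [set u] | u : H],
      forall k, (0 < k <= #|H|)%N -> partition (P k) [set: H] /\ #|P k| = k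
    & forall k, (0 < k < #|H|)%N ->
        exists S1 S2, [/\ S1 \in P k.+1, S2 \in P k.+1, S1 != S2
                        & P k = merge_parts (P k.+1) S1 S2]].

Definition eadj (L : choiceType) (e : L) (G : elgraph L) : rel G :=
  fun u v => (e == lab u v) || (e == lab v u).

Definition ecomponents (L : choiceType) (e : L) (G : elgraph L) :
    {set {set G}} :=
  equivalence_partition (connect (@eadj L e G)) [set: G].

Notation maps S T := {ffun {x | x \in S} -> {y | y \in T}}.

(* The set R^S_T. *)
Definition morphisms (L : choiceType) (R : {fset L * L}) (G H : elgraph L)
    (r : nat) (S : r.-tuple {set G}) (T : r.-tuple {set H}) :
    {set maps (\bigcup_(i < r) tnth S i) (\bigcup_(i < r) tnth T i)} :=
  [set f : maps _ _ | is_morphism R (G := induced (\bigcup_(i < r) tnth S i))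
                         (H := induced (\bigcup_(i < r) tnth T i)) f
         & [forall i : 'I_r, forall u,
              (val u \in tnth S i) ==> (val (f u) \in tnth T i)]].

Definition snoc (X : Type) (r : nat) (a : r.-tuple X) (x : X) :
    (r + 1).-tuple X :=
  cat_tuple a [tuple x].

Definition snoc2 (X : Type) (r : nat) (a : r.-tuple X) (x y : X) :
    (r + 2).-tuple X :=
  cat_tuple a [tuple x; y].

Definition subtuple (X : Type) (r : nat) (a : r.-tuple X) (I : {set 'I_r}) :
    #|I|.-tuple X :=
  [tuple tnth a (enum_val i) | i < #|I|].

(* H' is a contraction of H when this is used; the vertices in T are distinct
   and the sets in S pairwise disjoint. *)
Definition feasible (L : choiceType) (e : L) (R : {fset L * L})
    (G H' : elgraph L) (r : nat) (S : r.-tuple {set G}) (T : r.-tuple H') :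
    bool :=
  [forall i : 'I_r, forall i' : 'I_r,
     (lab (tnth T i) (tnth T i') != e) ==>
     [forall u in tnth S i, forall v in tnth S i',
        (lab u v, lab (tnth T i) (tnth T i')) \in R]].

Definition restricts (V V' : finType) (S S1 : {set V}) (T T1 : {set V'})
    (f : maps S T) (f1 : maps S1 T1) : bool :=
  [forall x, forall x1, (val x == val x1) ==> (val (f x) == val (f1 x1))].

Definition join (V V' : finType) (S1 S2 : {set V}) (T1 T2 : {set V'})
    (F1 : {set maps S1 T1}) (F2 : {set maps S2 T2}) :
    {set maps (S1 :|: S2) (T1 :|: T2)} :=
  [set f | [exists f1 in F1, exists f2 in F2,
              restricts f f1 && restricts f f2]].

Record premorphism (L : choiceType) (A : pzSemiRingType) (B : Type) :=
  PreMorphism {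
  pm_val :> forall (G H : elgraph L) (W : {ffun G * H -> B})
    (S : {set G}) (T : {set H}), {set maps S T} -> A;
  pm_add : forall (G H : elgraph L) (W : {ffun G * H -> B})
    (S : {set G}) (T : {set H}) (F1 F2 : {set maps S T}),
    [disjoint F1 & F2] ->
    pm_val W (F1 :|: F2) = pm_val W F1 + pm_val W F2;
  pm_join : forall (G H : elgraph L) (W : {ffun G * H -> B})
    (S1 S2 : {set G}) (T1 T2 : {set H})
    (F1 : {set maps S1 T1}) (F2 : {set maps S2 T2}),
    [disjoint S1 & S2] -> [disjoint T1 & T2] ->
    pm_val W (join F1 F2) = pm_val W F1 * pm_val W F2;
  pm_empty : forall (G H : elgraph L) (W : {ffun G * H -> B})
    (S : {set G}) (T : {set H}),
    pm_val W (set0 : {set maps S T}) = 0 }.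

(* Main.v *)
Require Import Defs.
From HB Require Import structures.
From mathcomp Require Import all_boot all_order all_algebra finmap.

Set Implicit Arguments.
Unset Strict Implicit.
Unset Printing Implicit Defensive.

Import GRing.Theory.
Local Open Scope ring_scope.

(* Split the morphisms on the left according to the preimages (S_p, S_{p+1})
   of T_p and T_{p+1}.  A nonempty class forces feasibility, since a label
   of H_{k+1} different from e is the constant value of l_H between the two
   parts.  Conversely, given feasibility, the morphism condition only has to be
   checked inside each e-connected component, because labels between distinct
   components are not e; so the class is the join of its restrictions to the
   components, and Omega is additive over classes and multiplicative over
   joins. *)

(** * Maps between subsets as functional relations, and their joins *)

Section Graphs.

Variables V V' : finType.
Implicit Types (S : {set V}) (T : {set V'}) (u : V) (v : V').

(* Maps whose domains and codomains are equal but not convertible sets are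
   compared through their graphs. *)
Definition in_graph S T (f : maps S T) u v : bool :=
  [exists x, (val x == u) && (val (f x) == v)].

Lemma in_graphP S T (f : maps S T) u v :
  reflect (exists x, val x = u /\ val (f x) = v) (in_graph f u v).
Proof.
apply: (iffP existsP) => [[x /andP[/eqP<- /eqP<-]]|[x [<- <-]]]; first by exists x.
by exists x; rewrite !eqxx.
Qed.

Lemma in_graph_val S T (f : maps S T) x : in_graph f (val x) (val (f x)).
Proof. by apply/in_graphP; exists x. Qed.

Lemma in_graph_dom S T (f : maps S T) u v : in_graph f u v -> u \in S.
Proof. by case/in_graphP=> x [<- _]; exact: valP. Qed.

Lemma in_graph_codom S T (f : maps S T) u v : in_graph f u v -> v \in T.
Proof. by case/in_graphP=> x [_ <-]; exact: valP. Qed.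

Lemma in_graph_total S T (f : maps S T) u :
  u \in S -> exists v, in_graph f u v.
Proof.
by move=> uS; exists (val (f (exist _ u uS))); apply/in_graphP; exists (exist _ u uS).
Qed.

Lemma in_graph_fun S T (f : maps S T) u v w :
  in_graph f u v -> in_graph f u w -> v = w.
Proof. by case/in_graphP=> x [<- <-] /in_graphP[y [/val_inj-> <-]]. Qed.

(** With [r] the graph of a map, this restricts the map to a smaller domain and codomain. *)
Lemma map_of_rel S T (r : V -> V' -> bool) :
  (forall u, u \in S -> exists2 v, v \in T & r u v) ->
  exists f : maps S T, forall u v, in_graph f u v -> r u v.
Proof.
move=> rtot.
have ex (x : {x | x \in S}) : exists y : {y | y \in T}, r (val x) (val y).
  by have [v vT rv] := rtot _ (valP x); exists (exist _ v vT).
exists [ffun x => xchoose (ex x)] => u v /in_graphP[x [<- <-]].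
by rewrite ffunE; exact: (xchooseP (ex x)).
Qed.

(** [restricts] tests only points common to both domains. A point of [S1] outside [S] would pass
    vacuously and yet have no pair in the graph of [f], hence the inclusion. *)
Lemma restrictsP S S1 T T1 (f : maps S T) (f1 : maps S1 T1) :
  S1 \subset S ->
  reflect (forall u v, in_graph f1 u v -> in_graph f u v) (restricts f f1).
Proof.
move=> /subsetP sS1; apply: (iffP forallP) => [fE u v f1uv|fE x].
  have [w fuw] := in_graph_total f (sS1 _ (in_graph_dom f1uv)).
  suff <- : w = v by [].
  case/in_graphP: fuw f1uv => x [<- <-] /in_graphP[x1 [xE <-]].
  by apply/eqP; have /forallP/(_ x1) := fE x; rewrite xE eqxx.
apply/forallP=> x1; apply/implyP=> /eqP xE; apply/eqP.
by apply: (in_graph_fun (in_graph_val f x)); rewrite xE; apply/fE/in_graph_val.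
Qed.

Lemma joinP S1 S2 T1 T2 (F1 : {set maps S1 T1}) (F2 : {set maps S2 T2})
    (f : maps (S1 :|: S2) (T1 :|: T2)) :
  reflect (exists f1 f2, [/\ f1 \in F1, f2 \in F2,
      forall u v, in_graph f1 u v -> in_graph f u v
    & forall u v, in_graph f2 u v -> in_graph f u v])
   (f \in join F1 F2).
Proof.
rewrite inE; apply: (iffP existsP) => [[f1 /andP[f1F /existsP[f2]]]|].
  case/and3P=> f2F /(restrictsP _ _ (subsetUl _ _)) rf1.
  by move=> /(restrictsP _ _ (subsetUr _ _)) rf2; exists f1, f2.
move=> [f1 [f2 [f1F f2F rf1 rf2]]]; exists f1; rewrite f1F; apply/existsP.
exists f2; rewrite f2F /=; apply/andP.
by split; [apply/(restrictsP _ _ (subsetUl _ _))|apply/(restrictsP _ _ (subsetUr _ _))].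
Qed.

End Graphs.

(** * Tuples extended by one or two entries *)

Lemma pairwise_tnth (X : Type) (p : X -> X -> bool) n (t : n.-tuple X) :
  symmetric p -> pairwise p t ->
  forall i j, i != j -> p (tnth t i) (tnth t j).
Proof.
move=> psym pt i j; have x0 := tnth t i.
have lt (a b : 'I_n) : (a < b)%N -> p (tnth t a) (tnth t b).
  move=> ab; rewrite !(tnth_nth x0).
  by apply: (pairwiseP x0 pt) => //; rewrite inE size_tuple.
by rewrite neq_ltn => /orP[/lt|/lt] //; rewrite psym.
Qed.

Section Snoc.

Variables (X : Type) (r : nat) (a : r.-tuple X).

Lemma tnth_snoc_old x i : tnth (snoc a x) (lshift 1 i) = tnth a i.
Proof. exact: tnth_lshift. Qed.

Lemma tnth_snoc_new x : tnth (snoc a x) (rshift r ord0) = x.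
Proof. exact: tnth_rshift. Qed.

Lemma tnth_snoc2_old x y i : tnth (snoc2 a x y) (lshift 2 i) = tnth a i.
Proof. exact: tnth_lshift. Qed.

Lemma tnth_snoc2_new x y :
  (tnth (snoc2 a x y) (rshift r ord0) = x) *
  (tnth (snoc2 a x y) (rshift r ord_max) = y).
Proof. by split; apply: tnth_rshift. Qed.

Lemma map_snoc2 (Y : Type) (g : X -> Y) x y :
  map_tuple g (snoc2 a x y) = snoc2 (map_tuple g a) (g x) (g y).
Proof. by apply: val_inj; rewrite /= map_cat. Qed.

End Snoc.

Lemma forall_ord_snoc r (Q : 'I_(r + 1) -> Prop) :
  (forall i, Q (lshift 1 i)) -> Q (rshift r ord0) -> forall i, Q i.
Proof. by move=> Ql Qr i; case: (split_ordP i) => j -> //; rewrite ord1. Qed.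

Lemma forall_ord_snoc2 r (Q : 'I_(r + 2) -> Prop) :
  (forall i, Q (lshift 2 i)) -> Q (rshift r ord0) -> Q (rshift r ord_max) ->
  forall i, Q i.
Proof.
move=> Ql Q0 Q1 i; case: (split_ordP i) => j -> //.
case: j => [[|[|//]] lt2]; first by rewrite (_ : Ordinal _ = ord0) //; apply: val_inj.
by rewrite (_ : Ordinal _ = ord_max) //; apply: val_inj.
Qed.

Lemma bigcup_snoc (V : finType) r (a : r.-tuple {set V}) x :
  \bigcup_(i < r + 1) tnth (snoc a x) i = \bigcup_(i < r) tnth a i :|: x.
Proof.
rewrite big_split_ord big_ord1 tnth_snoc_new; congr (_ :|: _).
by apply: eq_bigr => i _; rewrite tnth_snoc_old.
Qed.

Lemma bigcup_snoc2 (V : finType) r (a : r.-tuple {set V}) x y :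
  \bigcup_(i < r + 2) tnth (snoc2 a x y) i
  = \bigcup_(i < r) tnth a i :|: (x :|: y).
Proof.
rewrite big_split_ord big_ord_recl big_ord1 /=; congr (_ :|: _).
  by apply: eq_bigr => i _; rewrite tnth_snoc2_old.
rewrite tnth_snoc2_new (_ : lift _ _ = ord_max) ?tnth_snoc2_new //.
exact: val_inj.
Qed.

(** * Transport and additivity of pre-morphisms *)

Section Premorphism.

Variables (L : choiceType) (A : pzSemiRingType) (B : Type).
Variables (Omega : premorphism L A B) (G H : elgraph L).
Variable W : {ffun G * H -> B}.

(** This carries [Omega] across sets that are equal but not convertible. After substitution both
    families have the same type, and the hypothesis is applied to a map and itself. *)
Lemma eq_premorphism (S S' : {set G}) (T T' : {set H})
    (F : {set maps S T}) (F' : {set maps S' T'}) :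
  S = S' -> T = T' ->
  (forall f f', (forall u v, in_graph f u v = in_graph f' u v) ->
     (f \in F) <-> (f' \in F')) ->
  Omega G H W S T F = Omega G H W S' T' F'.
Proof.
move=> eS eT; subst S' T' => FF'; congr (Omega _ _ _ _ _ _).
by apply/setP=> f; apply/idP/idP => /(FF' f f (fun _ _ => erefl)).
Qed.

(** Induction on a duplicate-free list of values of [pi]: [pm_empty] starts it, and [pm_add] adds
    one fibre, disjoint from those over the rest of the list. *)
Lemma premorphism_fibers (K : finType) (S : {set G}) (T : {set H})
    (F : {set maps S T}) (pi : maps S T -> K) :
  Omega G H W S T F =
  \sum_(c : K) Omega G H W S T [set f in F | pi f == c].
Proof.
suff fib (s : seq K) : uniq s ->
    Omega G H W S T [set f in F | pi f \in s] =
    \sum_(c <- s) Omega G H W S T [set f in F | pi f == c].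
  rewrite -big_enum -fib ?enum_uniq //; congr (Omega _ _ _ _ _ _).
  by apply/setP=> f; rewrite !inE mem_enum andbT.
elim: s => [_|c s IHs /= /andP[cs us]].
  rewrite big_nil -[RHS](@pm_empty _ _ _ Omega G H W S T); congr (Omega _ _ _ _ _ _).
  by apply/setP=> f; rewrite !inE andbF.
rewrite big_cons -IHs // -pm_add.
  by congr (Omega _ _ _ _ _ _); apply/setP=> f; rewrite !inE -andb_orr.
apply/pred0P=> f; rewrite /= !inE.
by case: eqP => [->|]; rewrite ?(negbTE cs) ?andbF.
Qed.

Variable R : {fset L * L}.

Lemma morphismsP r (S : r.-tuple {set G}) (T : r.-tuple {set H})
    (f : maps (\bigcup_(i < r) tnth S i) (\bigcup_(i < r) tnth T i)) :
  reflect
    ((forall u u' v v', in_graph f u u' -> in_graph f v v' ->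
        (lab u v, lab u' v') \in R) /\
     (forall i u u', in_graph f u u' -> u \in tnth S i -> u' \in tnth T i))
    (f \in morphisms R S T).
Proof.
rewrite inE; apply: (iffP andP) => [[/forallP fR /forallP fT]|[fR fT]]; split.
- move=> u u' v v' /in_graphP[x [<- <-]] /in_graphP[y [<- <-]].
  exact: (forallP (fR x) y).
- move=> i u u' /in_graphP[x [<- <-]]; exact: (implyP (forallP (fT i) x)).
- by apply/forallP=> x; apply/forallP=> y; apply: fR; apply: in_graph_val.
- apply/forallP=> i; apply/forallP=> x; apply/implyP; apply: fT.
  exact: in_graph_val.
Qed.

(** * Multiplicativity over groups of blocks *)

Section Blocks.

Variables (n : nat) (S : n.-tuple {set G}) (T : n.-tuple {set H}).

Lemma bigcup_subtuple (V : finType) (X : n.-tuple {set V}) (J : {set 'I_n}) :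
  \bigcup_(i < #|J|) tnth (subtuple X J) i = \bigcup_(i in J) tnth X i.
Proof. by rewrite [RHS]big_enum_val; apply: eq_bigr => i _; rewrite tnth_mktuple. Qed.

(** A subtuple is indexed by ['I_#|J|]; going back to indices in [J] makes subtuples for different
    [J] comparable. *)
Lemma morphisms_subtupleP (J : {set 'I_n})
    (f : maps (\bigcup_(i < #|J|) tnth (subtuple S J) i)
              (\bigcup_(i < #|J|) tnth (subtuple T J) i)) :
  reflect
    ((forall u u' v v', in_graph f u u' -> in_graph f v v' ->
        (lab u v, lab u' v') \in R) /\
     (forall i, i \in J ->
        forall u u', in_graph f u u' -> u \in tnth S i -> u' \in tnth T i))
    (f \in morphisms R (subtuple S J) (subtuple T J)).
Proof.
apply: (iffP (morphismsP _)) => -[fR fT]; split=> // i.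
  move=> iJ u u' /(fT (enum_rank_in iJ i)).
  by rewrite !tnth_mktuple enum_rankK_in.
by move=> u u'; rewrite !tnth_mktuple; apply: fT; apply: enum_valP.
Qed.

Hypothesis disjS : forall i j, i != j -> [disjoint tnth S i & tnth S j].
Hypothesis disjT : forall i j, i != j -> [disjoint tnth T i & tnth T j].

(** The label condition from block [i] to block [j] holds for every map that respects these
    blocks. *)
Definition compatible (i j : 'I_n) : Prop :=
  forall u u' v v', u \in tnth S i -> u' \in tnth T i ->
    v \in tnth S j -> v' \in tnth T j -> (lab u v, lab u' v') \in R.

Lemma disjoint_bigcups (V : finType) (X : 'I_n -> {set V}) (J1 J2 : {set 'I_n}) :
  (forall i j, i != j -> [disjoint X i & X j]) -> [disjoint J1 & J2] ->
  [disjoint \bigcup_(i in J1) X i & \bigcup_(i in J2) X i].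
Proof.
move=> dX dJ; apply/pred0P=> x; apply/negP=> /andP[/bigcupP[i iJ xi] /bigcupP[j jJ xj]].
have ij : i != j by apply: contraTneq jJ => <-; rewrite (disjointFr dJ iJ).
by have := disjointFr (dX _ _ ij) xi; rewrite xj.
Qed.

(** Restricting a morphism to both groups of blocks and gluing two morphisms together are inverse
    operations: the label condition on a glued map holds within a group by assumption and across
    groups by compatibility, so [pm_join] applies. *)
Lemma premorphism_subtupleU (J1 J2 : {set 'I_n}) :
  [disjoint J1 & J2] ->
  (forall i j, i \in J1 -> j \in J2 -> compatible i j /\ compatible j i) ->
  Omega G H W _ _ (morphisms R (subtuple S (J1 :|: J2)) (subtuple T (J1 :|: J2)))
  = Omega G H W _ _ (morphisms R (subtuple S J1) (subtuple T J1)) *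
    Omega G H W _ _ (morphisms R (subtuple S J2) (subtuple T J2)).
Proof.
move=> dJ cJ; rewrite -pm_join; last 2 first.
- by rewrite !bigcup_subtuple; apply: disjoint_bigcups.
- by rewrite !bigcup_subtuple; apply: disjoint_bigcups.
apply: eq_premorphism; rewrite ?bigcup_subtuple ?bigcup_setU //.
move=> f f' ff'.
(* The restriction of [f] to the blocks in [J] lands in the matching blocks of [T], because [f]
   respects each block. *)
have side (J : {set 'I_n}) : J \subset J1 :|: J2 ->
    f \in morphisms R (subtuple S (J1 :|: J2)) (subtuple T (J1 :|: J2)) ->
    exists2 g, g \in morphisms R (subtuple S J) (subtuple T J) &
      forall u v, in_graph g u v -> in_graph f' u v.
  move=> /subsetP sJ /morphisms_subtupleP[fR fT].
  have [u uS|g gf] := @map_of_rel _ _ (\bigcup_(i < #|J|) tnth (subtuple S J) i)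
    (\bigcup_(i < #|J|) tnth (subtuple T J) i) (in_graph f).
    move: uS; rewrite bigcup_subtuple => /bigcupP[i iJ ui].
    have [v fuv] : exists v, in_graph f u v.
      apply: in_graph_total; rewrite bigcup_subtuple.
      by apply/bigcupP; exists i => //; apply: sJ.
    exists v => //; rewrite bigcup_subtuple; apply/bigcupP; exists i => //.
    exact: fT (sJ _ iJ) _ _ fuv ui.
  exists g; last by move=> u v /gf; rewrite ff'.
  apply/morphisms_subtupleP; split=> [u u' v v' /gf fu /gf|]; first exact: fR.
  by move=> i /sJ iJ u u' /gf; apply: fT.
split=> [fM|/joinP[f1 [f2 [/morphisms_subtupleP[R1 T1] /morphisms_subtupleP[R2 T2] s1 s2]]]].
  have [f1 f1M s1] := side J1 (subsetUl _ _) fM.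
  have [f2 f2M s2] := side J2 (subsetUr _ _) fM.
  by apply/joinP; exists f1, f2.
(* Over the blocks in [J], the graph of [f] lies in that of its part [g]: [g] is total there and [f]
   is single-valued. *)
have lift (J : {set 'I_n}) (g : maps (\bigcup_(i < #|J|) tnth (subtuple S J) i)
    (\bigcup_(i < #|J|) tnth (subtuple T J) i)) i u u' :
    (forall u v, in_graph g u v -> in_graph f' u v) ->
    i \in J -> u \in tnth S i -> in_graph f u u' -> in_graph g u u'.
  move=> sg iJ ui; rewrite ff' => fu.
  have [w gw] : exists w, in_graph g u w.
    by apply: in_graph_total; rewrite bigcup_subtuple; apply/bigcupP; exists i.
  by rewrite (in_graph_fun fu (sg _ _ gw)).
have fE u u' : in_graph f u u' -> exists2 i, u \in tnth S i /\ u' \in tnth T i &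
    (i \in J1) && in_graph f1 u u' || (i \in J2) && in_graph f2 u u'.
  move=> fu; have := in_graph_dom fu.
  rewrite bigcup_subtuple => /bigcupP[i]; rewrite inE => /orP[] iJ ui; exists i.
  - by split=> //; apply: (T1 i iJ u) => //; apply: (lift _ _ _ _ _ s1 iJ ui fu).
  - by rewrite iJ (lift _ _ _ _ _ s1 iJ ui fu).
  - by split=> //; apply: (T2 i iJ u) => //; apply: (lift _ _ _ _ _ s2 iJ ui fu).
  - by rewrite iJ (lift _ _ _ _ _ s2 iJ ui fu) orbT.
apply/morphisms_subtupleP; split=> [u u' v v' /fE[i [ui ui'] ci] /fE[j [vj vj'] cj]|].
  (* Of the four cases, the two mixed ones use compatibility, once in each direction. *)
  case/orP: ci cj => /andP[iJ fi] /orP[] /andP[jJ fj].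
  - exact: R1 fi fj.
  - by have [c _] := cJ _ _ iJ jJ; apply: c.
  - by have [_ c] := cJ _ _ jJ iJ; apply: c.
  - exact: R2 fi fj.
move=> i; rewrite inE => /orP[] iJ u u' fu ui.
  exact: (T1 i iJ _ _ (lift _ _ _ _ _ s1 iJ ui fu) ui).
exact: (T2 i iJ _ _ (lift _ _ _ _ _ s2 iJ ui fu) ui).
Qed.

(* At least one block is needed: Omega of the empty map may differ from 1. *)
Lemma premorphism_blocks (q : nat) (J : 'I_q.+1 -> {set 'I_n}) :
  (forall a b, a != b -> [disjoint J a & J b]) ->
  (forall a b i j, a != b -> i \in J a -> j \in J b -> compatible i j) ->
  Omega G H W _ _ (morphisms R (subtuple S (\bigcup_a J a))
                               (subtuple T (\bigcup_a J a)))
  = \prod_a Omega G H W _ _ (morphisms R (subtuple S (J a)) (subtuple T (J a))).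
Proof.
elim: q J => [|q IHq] J dJ cJ; first by rewrite !big_ord1.
(* The last block is split off on the right, which keeps the order of the factors, since [A] may be
   noncommutative; [wi] separates its index from the earlier ones. *)
have wi (a : 'I_q.+1) : widen_ord (leqnSn q.+1) a != ord_max.
  by rewrite -val_eqE /= neq_ltn ltn_ord.
rewrite [RHS]big_ord_recr /= big_ord_recr /= premorphism_subtupleU.
- rewrite IHq // => a b; first by move=> ab; apply: dJ.
  by move=> i j ab; apply: cJ.
- apply/pred0P=> i; apply/negP=> /andP[/bigcupP[a _ ia] /= im].
  by have := disjointFr (dJ _ _ (wi a)) ia; rewrite (im : i \in J ord_max).
move=> i j /bigcupP[a _ ia] jm; split; last by apply: cJ jm ia; rewrite eq_sym.
by apply: cJ ia jm.
Qed.

End Blocks.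

(** Both sides describe the same maps, but the left tuples have length [#|setT|], so the comparison
    goes through graphs. *)
Lemma premorphism_subtupleT n (S : n.-tuple {set G}) (T : n.-tuple {set H}) :
  Omega G H W _ _ (morphisms R (subtuple S setT) (subtuple T setT))
  = Omega G H W _ _ (morphisms R S T).
Proof.
apply: eq_premorphism; try by rewrite bigcup_subtuple; apply: eq_bigl => i; rewrite inE.
move=> f f' ff'.
split=> [/morphisms_subtupleP[fR fT]|/morphismsP[fR fT]].
  by apply/morphismsP; split=> [u u' v v'|i u u']; rewrite -!ff'; [apply: fR|apply: fT].
apply/morphisms_subtupleP.
by split=> [u u' v v'|i _ u u']; rewrite !ff'; [apply: fR|apply: fT].
Qed.

(** * Splitting the merged block by preimages *)

Section Fibers.

Variables (r : nat) (S : r.-tuple {set G}) (S0 : {set G}).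
Variables (T : r.-tuple {set H}) (Y Z : {set H}).
Hypothesis disjYZ : [disjoint Y & Z].

(** Defined for every map so that it can index fibres; the two sets are sure to partition [S0] only
    for morphisms. *)
Definition preimages
    (f : maps (\bigcup_(i < r + 1) tnth (snoc S S0) i)
              (\bigcup_(i < r + 1) tnth (snoc T (Y :|: Z)) i)) :
    {set G} * {set G} :=
  ([set u in S0 | [exists v in Y, in_graph f u v]],
   [set u in S0 | [exists v in Z, in_graph f u v]]).

(** The right side is membership in the morphisms of the refined tuples, stated for a map of the
    unrefined type. A morphism sends each point of [S0] into exactly one of [Y] and [Z]; conversely,
    the refined block conditions determine both preimages. *)
Lemma preimagesP f (U : {set G} * {set G}) :
  f \in morphisms R (snoc S S0) (snoc T (Y :|: Z)) /\ preimages f = U <->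
  [/\ [disjoint U.1 & U.2], U.1 :|: U.2 = S0,
      forall u u' v v', in_graph f u u' -> in_graph f v v' ->
        (lab u v, lab u' v') \in R
    & forall i u u', in_graph f u u' ->
        u \in tnth (snoc2 S U.1 U.2) i -> u' \in tnth (snoc2 T Y Z) i].
Proof.
split=> [[/morphismsP[fR fT] <-]|].
  have fS0 u : u \in S0 -> exists2 v, in_graph f u v & (v \in Y) || (v \in Z).
    move=> uS; have [|v fuv] := @in_graph_total _ _ _ _ f u.
      by rewrite bigcup_snoc inE uS orbT.
    exists v => //; have := fT (rshift r ord0) _ _ fuv.
    by rewrite !tnth_snoc_new inE; apply.
  split=> //.
  - apply/pred0P=> u; apply/negP; rewrite /= !inE => /andP[/andP[_ /existsP[v]]].
    case/andP=> vY fuv /andP[_ /existsP[w /andP[wZ fuw]]].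
    have := disjointFr disjYZ vY.
    by rewrite (in_graph_fun fuv fuw) wZ.
  - apply/setP=> u; rewrite !inE -andb_orr andb_idr // => /fS0[v fuv].
    by case/orP=> vYZ; apply/orP; [left|right]; apply/existsP; exists v; rewrite vYZ.
  apply: forall_ord_snoc2 => [i||] u u' fuu'.
  - by rewrite !tnth_snoc2_old; have := fT (lshift 1 i) _ _ fuu'; rewrite !tnth_snoc_old.
  - rewrite !tnth_snoc2_new inE => /andP[_ /existsP[v /andP[vY fuv]]].
    by rewrite (in_graph_fun fuu' fuv).
  - rewrite !tnth_snoc2_new inE => /andP[_ /existsP[v /andP[vY fuv]]].
    by rewrite (in_graph_fun fuu' fuv).
case: U => U1 U2 /= [dU US fR fT].
have fU1 u u' : in_graph f u u' -> u \in U1 -> u' \in Y.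
  by move=> /(fT (rshift r ord0)); rewrite !tnth_snoc2_new.
have fU2 u u' : in_graph f u u' -> u \in U2 -> u' \in Z.
  by move=> /(fT (rshift r ord_max)); rewrite !tnth_snoc2_new.
have fS0 u : u \in S0 -> exists v, in_graph f u v.
  by move=> uS; apply: in_graph_total; rewrite bigcup_snoc inE uS orbT.
split.
  apply/morphismsP; split=> //; apply: forall_ord_snoc => [i|] u u' fuu'.
    by rewrite !tnth_snoc_old; have := fT (lshift 2 i) _ _ fuu'; rewrite !tnth_snoc2_old.
  rewrite !tnth_snoc_new -US !inE => /orP[/(fU1 _ _ fuu')->//|/(fU2 _ _ fuu')->].
  by rewrite orbT.
congr (_, _); apply/setP=> u; rewrite !inE; apply/andP/idP.
- case=> uS /existsP[v /andP[vY fuv]]; move: uS; rewrite -US inE => /orP[//|uU].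
  by have := disjointFr disjYZ vY; rewrite (fU2 _ _ fuv uU).
- move=> uU; have uS : u \in S0 by rewrite -US inE uU.
  split=> //; have [v fuv] := fS0 u uS; apply/existsP; exists v.
  by rewrite (fU1 _ _ fuv uU).
- case=> uS /existsP[v /andP[vZ fuv]]; move: uS; rewrite -US inE => /orP[uU|//].
  by have := disjointFr disjYZ (fU1 _ _ fuv uU); rewrite vZ.
- move=> uU; have uS : u \in S0 by rewrite -US inE uU orbT.
  split=> //; have [v fuv] := fS0 u uS; apply/existsP; exists v.
  by rewrite (fU2 _ _ fuv uU).
Qed.

Lemma premorphism_preimages (U : {set G} * {set G}) :
  [disjoint U.1 & U.2] -> U.1 :|: U.2 = S0 ->
  Omega G H W _ _ [set f in morphisms R (snoc S S0) (snoc T (Y :|: Z))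
                  | preimages f == U]
  = Omega G H W _ _ (morphisms R (snoc2 S U.1 U.2) (snoc2 T Y Z)).
Proof.
move=> dU US; apply: eq_premorphism; rewrite ?bigcup_snoc ?bigcup_snoc2 ?US //.
move=> f f' ff'; rewrite inE; split=> [/andP[fM /eqP fU]|/morphismsP[fR fT]].
  have [//|_ _ fR fT] := (preimagesP f U).1.
  by apply/morphismsP; split=> [u u' v v'|i u u']; rewrite -!ff'; [apply: fR|apply: fT].
have [|-> ->] := (preimagesP f U).2; last by rewrite eqxx.
by split=> // [u u' v v'|i u u']; rewrite !ff'; [apply: fR|apply: fT].
Qed.

End Fibers.

End Premorphism.

(** * Labels of contractions and [e]-connected components *)

(** A label other than [e] cannot be the default of the failed search, so it is the constant value
    found by [pick]. *)
Lemma contraction_labE (L : choiceType) (e : L) (H : elgraph L)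
    (S1 S2 : {set H}) u v :
  contraction_lab e S1 S2 != e -> u \in S1 -> v \in S2 ->
  contraction_lab e S1 S2 = lab u v.
Proof.
rewrite /contraction_lab; case: pickP => [x /forall_inP Hx _ uS vS|_]; last by rewrite eqxx.
by apply/esym/eqP; exact: (forall_inP (Hx u uS)).
Qed.

Section EComponents.

Variables (L : choiceType) (e : L) (G : elgraph L).

Lemma connect_eadj_equivalence :
  {in [set: G] & &, equivalence_rel (connect (@eadj L e G))}.
Proof.
have csym : connect_sym (@eadj L e G).
  by apply: sym_connect_sym => u v; rewrite /eadj orbC.
move=> u v w _ _ _; split=> [|uv]; first exact: connect0.
exact: same_connect.
Qed.

Lemma trivIset_ecomponents : trivIset (ecomponents e G).
Proof. by case/and3P: (equivalence_partitionP connect_eadj_equivalence). Qed.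

(** Used in contrapositive form: labels between distinct components differ from [e]. *)
Lemma ecomponents_eadj (X Y : {set G}) x y :
  X \in ecomponents e G -> Y \in ecomponents e G ->
  x \in X -> y \in Y -> eadj e x y -> X = Y.
Proof.
have tI := trivIset_ecomponents.
move=> XC YC xX yY xy; rewrite -(def_pblock tI YC yY) -(def_pblock tI XC xX).
apply/esym/same_pblock => //.
by rewrite (pblock_equivalence_partition connect_eadj_equivalence) ?inE // connect1.
Qed.

End EComponents.

(* Here r stands for p - 1; Tp, Tp1 are the vertices T_p, T_{p+1}. *)
Theorem theorem5 (L : choiceType) (e : L)
    (A : pzSemiRingType) (B : Type) (Omega : premorphism L A B)
    (G H : elgraph L) (W : {ffun G * H -> B})
    (hG : efree e G) (hH : efree e H)
    (R : {fset L * L}) (hR : (R `<=` labels G `*` labels H)%fset)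
    (P : nat -> {set {set H}}) (hP : contraction_seq P)
    (k : nat) (hk : (0 < k < #|H|)%N)
    (r : nat) (T : r.-tuple (contraction e (P k.+1)))
    (Tp Tp1 : contraction e (P k.+1))
    (hT : uniq (snoc2 T Tp Tp1))
    (hmerge : P k = merge_parts (P k.+1) (part Tp) (part Tp1))
    (q : nat) (hq : (0 < q)%N)
    (C : 'I_q -> {set contraction e (P k.+1)})
    (hCinj : injective C)
    (hC : forall j, C j \in ecomponents e (contraction e (P k.+1)))
    (hTC : [set x in snoc2 T Tp Tp1] = \bigcup_(j < q) C j)
    (I : 'I_q -> {set 'I_(r + 2)})
    (hI : forall j, C j = [set tnth (snoc2 T Tp Tp1) i | i in I j])
    (S : r.-tuple {set G}) (S0 : {set G})
    (hS : pairwise (fun X Y : {set G} => [disjoint X & Y]) (snoc S S0)) :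
  Omega G H W _ _
    (morphisms R (snoc S S0)
       (snoc (map_tuple (@part L e H (P k.+1)) T) (part Tp :|: part Tp1)))
  = \sum_(U : {set G} * {set G} |
          [&& [disjoint U.1 & U.2], U.1 :|: U.2 == S0
            & feasible e R (snoc2 S U.1 U.2) (snoc2 T Tp Tp1)])
      \prod_(j < q)
        Omega G H W _ _
          (morphisms R
             (subtuple (snoc2 S U.1 U.2) (I j))
             (subtuple (map_tuple (@part L e H (P k.+1)) (snoc2 T Tp Tp1))
                (I j))).
Proof.
(* As [k < #|H|], the family [P k.+1] is a partition, and its parts are pairwise disjoint. *)
have [_ /(_ k.+1)] := hP; case/andP: hk => k0 kH.
move=> /(_ kH)[/and3P[_ tP _] _] _.
have inj2 := tuple_uniqP _ hT; set T2 := snoc2 T Tp Tp1 in hT inj2 hTC hI *.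
have disjT i j : i != j ->
    [disjoint tnth (map_tuple (@part L e H (P k.+1)) T2) i
            & tnth (map_tuple (@part L e H (P k.+1)) T2) j].
  move=> ij; rewrite !tnth_map; apply: (trivIsetP tP); try exact: valP.
  by apply: contra ij => /eqP/val_inj/inj2 ->.
have disjp : [disjoint part Tp & part Tp1].
  have := disjT (rshift r ord0) (rshift r ord_max).
  by rewrite map_snoc2 !tnth_snoc2_new; apply; rewrite eq_rshift.
(* The components exhaust the entries of [T2], and these are distinct, so an entry determines its
   index. *)
have cover_I : \bigcup_j I j = setT.
  apply/setP=> i; rewrite inE; apply/bigcupP.
  have : tnth T2 i \in \bigcup_j C j by rewrite -hTC inE mem_tnth.
  case/bigcupP=> j _; rewrite hI => /imsetP[i' i'I /inj2->].
  by exists j.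
have memC i j : i \in I j -> tnth T2 i \in C j.
  by move=> iI; rewrite hI; apply/imsetP; exists i.
have disjI a b : a != b -> [disjoint I a & I b].
  move=> ab; apply/pred0P=> i; apply/negP=> /andP[/memC ia /memC ib].
  have Cab : C a != C b by apply: contra ab => /eqP/hCinj->.
  by have := disjointFr (trivIsetP (trivIset_ecomponents _ _) _ _ (hC a) (hC b) Cab) ia; rewrite ib.
have labE i j u v : lab (tnth T2 i) (tnth T2 j) != e ->
    u \in part (tnth T2 i) -> v \in part (tnth T2 j) ->
    lab (tnth T2 i) (tnth T2 j) = lab u v.
  exact: contraction_labE.
(* The fibres run over all pairs [U]; on the right, [big_mkcond] gives the inadmissible pairs the
   term 0. *)
rewrite (premorphism_fibers _ _ _ (@preimages _ _ _ _ _ _ _ _ _)) [RHS]big_mkcond.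
apply: eq_bigr => U _; case: ifP => [/and3P[dU /eqP US feasU]|infeasU]; last first.
  (* A map in the fibre over [U] would make [U] an admissible pair, so here the fibre is empty. *)
  apply: etrans (pm_empty Omega W _ _); congr (Omega _ _ _ _ _ _).
  apply/setP=> f; rewrite [RHS]inE inE; apply/negP=> /andP[fM /eqP fU].
  have [//|dU US fR fT] := (preimagesP R disjp f U).1.
  move: infeasU; rewrite dU US eqxx /= => /negP; apply.
  have dom u i : u \in tnth (snoc2 S U.1 U.2) i ->
      exists2 u', in_graph f u u' & u' \in part (tnth T2 i).
    move=> ui; have [|u' fu] := @in_graph_total _ _ _ _ f u.
      by rewrite bigcup_snoc -US -bigcup_snoc2; apply/bigcupP; exists i.
    by exists u' => //; have := fT i _ _ fu ui; rewrite -map_snoc2 tnth_map.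
  apply/forallP=> i; apply/forallP=> j; apply/implyP=> ne.
  apply/forall_inP=> u /dom[u' fu u'i]; apply/forall_inP=> v /dom[v' fv v'j].
  (* The label of the contraction is that of the image pair in [H], so feasibility is the morphism
     condition on [f]. *)
  by rewrite (labE _ _ _ _ ne u'i v'j); apply: fR.
rewrite premorphism_preimages // -map_snoc2 -premorphism_subtupleT -cover_I.
(* [premorphism_blocks] expects a successor number of blocks, supplied by [0 < q]. *)
case: q hq C hCinj hC hTC I hI cover_I memC disjI => // q' _ C.
move=> hCinj hC hTC I hI cover_I memC disjI.
apply: premorphism_blocks => //.
  (* Disjointness of the refined tuple: [U.1] and [U.2] are disjoint subsets of [S0], which is
     disjoint from each entry of [S]. *)
  apply: (@pairwise_tnth _ (fun X Y : {set G} => [disjoint X & Y])); first by move=> X Y; rewrite disjoint_sym.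
  move: hS; rewrite /= !pairwise_cat /= dU !andbT => /andP[/allrelP SS0 ->].
  have SU (V X : {set G}) : V \subset S0 -> X \in (S : seq _) -> [disjoint X & V].
    by move=> VS XS; apply: (disjointWr VS); apply: SS0 => //; rewrite inE.
  rewrite andbT; apply/allrelP=> X Y XS; rewrite !inE.
  by case/orP=> /eqP->; apply: SU => //; rewrite -US ?subsetUl ?subsetUr.
move=> a b i j ab /memC ia /memC jb u u' v v' ui; rewrite !tnth_map => u'i vj v'j.
(* Blocks [i] and [j] lie in distinct components, so their label is not [e] and feasibility
   applies. *)
have ne : lab (tnth T2 i) (tnth T2 j) != e.
  apply: contra ab => /eqP lab_e; apply/eqP/hCinj.
  apply: ecomponents_eadj (hC a) (hC b) ia jb _.
  by rewrite /eadj lab_e eqxx.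
rewrite -(labE _ _ _ _ ne u'i v'j).
have /forallP/(_ i)/forallP/(_ j)/implyP/(_ ne) := feasU.
by move=> /forall_inP/(_ u ui)/forall_inP/(_ v vj).
Qed.
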